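(* Let $R$ be a commutative Noetherian ring of prime characteristic $p$. Assume that $R$ has a $p^{m_0}$-weak test element for some $m_0\in\mathbb{N}_0$; let $\mathfrak{a}$ be a proper ideal of $R$. Suppose that $(\mathfrak{a}_n)_{n\in\mathbb{N}_0}$ is an $f$-sequence of ideals of $R$ which has linear growth of primary decompositions and is such that $\mathfrak{a}^{[p^n]}\subseteq\mathfrak{a}_n\subseteq(\mathfrak{a}^{[p^n]})^*$ for all $n\in\mathbb{N}_0$. (i) For each $u\in R$, we have $\mathfrak{a}^*R_u=(\mathfrak{a}R_u)^*$, where $R_u$ is the localization of $R$ at the powers of $u$. (ii) If $\bigcup_{n\in\mathbb{N}_0}\operatorname{ass}\mathfrak{a}_n$ is a finite set, then $\mathfrak{a}^*S^{-1}R=(\mathfrak{a}S^{-1}R)^*$ for every multiplicatively closed subset $S$ of $R$.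
   Context: Rings have identity; $\mathbb{N}_0$ is the set of non-negative integers. $f:R\to R$, $r\mapsto r^p$, is the Frobenius homomorphism. For an ideal $\mathfrak{a}$ of a ring of characteristic $p$, $\mathfrak{a}^{[p^n]}$ is the ideal generated by all $p^n$-th powers of elements of $\mathfrak{a}$. For a commutative Noetherian ring $A$ of characteristic $p$, $A^{\circ}$ is the complement in $A$ of the union of the minimal primes of $A$. The tight closure $\mathfrak{b}^*$ of an ideal $\mathfrak{b}$ of $A$ is the ideal of all $r\in A$ for which there exists $c\in A^{\circ}$ with $cr^{p^n}\in\mathfrak{b}^{[p^n]}$ for all $n\gg0$. (Thus $(\mathfrak{a}S^{-1}R)^*$ is computed in $S^{-1}R$.) A $p^{m_0}$-weak test element for $A$ is an element $c\in A^{\circ}$ such that, for every ideal $\mathfrak{b}$ of $A$ and every $r\in A$, one has $r\in\mathfrak{b}^*$ if and only if $cr^{p^n}\in\mathfrak{b}^{[p^n]}$ for all $n\ge m_0$. An $f$-sequence of ideals of $R$ is a sequence $(\mathfrak{a}_n)_{n\in\mathbb{N}_0}$ of ideals of $R$ with $f^{-1}(\mathfrak{a}_{n+1})=\mathfrak{a}_n$ for all $n$. For an ideal $\mathfrak{b}$ of $R$, $\operatorname{ass}\mathfrak{b}$ is the set of associated primes of $\mathfrak{b}$, i.e. the radicals of the components of a minimal primary decomposition of $\mathfrak{b}$. An $f$-sequence $(\mathfrak{a}_n)_n$ of proper ideals of $R$ has linear growth of primary decompositions if there is a positive integer $h$ such that for every $n\in\mathbb{N}_0$ there is a minimal primary decomposition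 $\mathfrak{a}_n=\mathfrak{q}_{1,n}\cap\cdots\cap\mathfrak{q}_{k_n,n}$ with $\big((\sqrt{\mathfrak{q}_{i,n}})^{[p^n]}\big)^h\subseteq\mathfrak{q}_{i,n}$ for all $i=1,\ldots,k_n$. *)

(* Defs.v *)
From HB Require Import structures.
From mathcomp Require Import all_boot all_order all_algebra.
From mathcomp Require Import boolp classical_sets cardinality.
From mathcomp Require Import generic_quotient.
From mathcomp Require Import ring.

Set Implicit Arguments.
Unset Strict Implicit.
Unset Printing Implicit Defensive.

Import GRing.Theory.
Local Open Scope classical_set_scope.
Local Open Scope ring_scope.
Local Open Scope quotient_scope.

(* Ideals are Prop-valued sets, and may be the whole ring (the ideals of
   ring_quotient.v are proper).  Rings may be trivial, because a localization
   may be. *)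
Section Ideals.
Variable A : comPzRingType.
Implicit Types (I J P Q X : set A).

Definition is_ideal I : Prop :=
  [/\ I 0, forall x y, I x -> I y -> I (x + y) & forall a x, I x -> I (a * x)].

Definition ideal_gen X : set A := smallest is_ideal X.

Definition ideal_mul I J : set A := ideal_gen [set x * y | x in I & y in J].

Definition ideal_pow I (h : nat) : set A := iter h (ideal_mul I) setT.

Definition noetherian : Prop :=
  forall I, is_ideal I -> exists s : seq A, I = ideal_gen [set` s].

Definition radical I : set A := [set x | exists n : nat, I (x ^+ n)].

Definition prime_ideal P : Prop :=
  [/\ is_ideal P, ~ P 1 & forall x y, P (x * y) -> P x \/ P y].

Definition minimal_prime P : Prop :=
  prime_ideal P /\ forall Q, prime_ideal Q -> Q `<=` P -> Q = P.

Definition primary_ideal Q : Prop :=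
  [/\ is_ideal Q, ~ Q 1 & forall x y, Q (x * y) -> Q x \/ radical Q y].

Definition minimal_primary_decomposition I (k : nat) (q : 'I_k -> set A) : Prop :=
  [/\ forall i, primary_ideal (q i),
      I = \bigcap_i q i,
      injective (fun i => radical (q i)) &
      forall j, ~ (\bigcap_(i in [set i | i != j]) q i `<=` q j)].

(* The radicals occurring in a minimal primary decomposition do not depend on
   the decomposition (first uniqueness theorem). *)
Definition ass I : set (set A) :=
  [set P | exists (k : nat) (q : 'I_k -> set A),
     minimal_primary_decomposition I q /\ exists i, P = radical (q i)].

Definition off_minimal_primes : set A := ~` \bigcup_(P in minimal_prime) P.

Variable p : nat.

Definition frobenius_power I (n : nat) : set A :=
  ideal_gen [set x ^+ (p ^ n) | x in I].

Definition tight_closure I : set A :=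
  [set r | exists2 c, off_minimal_primes c & exists N : nat, forall n : nat,
     (N <= n)%N -> frobenius_power I n (c * r ^+ (p ^ n))].

Definition weak_test_element (m0 : nat) (c : A) : Prop :=
  off_minimal_primes c /\
  forall I, is_ideal I -> forall r,
    tight_closure I r <->
    (forall n : nat, (m0 <= n)%N -> frobenius_power I n (c * r ^+ (p ^ n))).

Definition f_sequence (a : nat -> set A) : Prop :=
  (forall n, is_ideal (a n)) /\
  (forall n, (fun r : A => r ^+ p) @^-1` a n.+1 = a n).

Definition linear_growth (a : nat -> set A) : Prop :=
  [/\ f_sequence a, forall n, a n <> setT &
   exists2 h : nat, (0 < h)%N & forall n : nat,
     exists (k : nat) (q : 'I_k -> set A),
       minimal_primary_decomposition (a n) q /\
       forall i, ideal_pow (frobenius_power (radical (q i)) n) h `<=` q i].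

End Ideals.

Arguments noetherian A : clear implicits.

Section Localization.
Variables (R : comPzRingType) (S : mulrClosed R).

Local Notation dens := {s : R | s \in S}.
Local Notation pairs := (R * dens)%type.
Implicit Types x y : pairs.

Definition loc_rel x y : bool :=
  `[< exists2 u, u \in S & u * (x.1 * sval y.2) = u * (y.1 * sval x.2) >].

Fact loc_rel_refl : reflexive loc_rel.
Proof. by move=> x; apply/asboolP; exists 1; rewrite ?rpred1. Qed.

Fact loc_rel_sym : symmetric loc_rel.
Proof.
by move=> x y; apply/idP/idP => /asboolP[u uS e]; apply/asboolP; exists u.
Qed.

Fact loc_rel_trans : transitive loc_rel.
Proof.
move=> y x z /asboolP[u uS e] /asboolP[v vS e']; apply/asboolP.
exists (u * v * sval y.2); first by rewrite !rpredM // (valP y.2).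
transitivity (v * sval z.2 * (u * (x.1 * sval y.2))); first by ring.
rewrite e; transitivity (u * sval x.2 * (v * (y.1 * sval z.2))); first by ring.
by rewrite e'; ring.
Qed.

Canonical loc_rel_equiv :=
  EquivRel loc_rel loc_rel_refl loc_rel_sym loc_rel_trans.

Definition localization := {eq_quot loc_rel}.
#[warnings="-redundant-canonical-projection"]
HB.instance Definition _ : EqQuotient _ loc_rel localization :=
  EqQuotient.on localization.
#[warnings="-redundant-canonical-projection"]
HB.instance Definition _ := Choice.on localization.

Definition loc_frac (a : R) (s : dens) : localization := \pi_localization (a, s).

Lemma loc_fracP a s b t : loc_frac a s = loc_frac b t <->
  exists2 u, u \in S & u * (a * sval t) = u * (b * sval s).
Proof.
split=> [/eqmodP|h]; first by move/asboolP.
by apply/eqmodP/asboolP.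
Qed.

Lemma loc_frac_surj (z : localization) : exists a s, z = loc_frac a s.
Proof.
by elim/quotW: z => -[a s]; exists a, s.
Qed.

Definition den1 : dens := exist _ 1 (rpred1 S).
Definition denM (s t : dens) : dens :=
  exist _ (sval s * sval t) (rpredM (valP s) (valP t)).

Definition loc_add (z w : localization) : localization :=
  let x := repr z in let y := repr w in
  loc_frac (x.1 * sval y.2 + y.1 * sval x.2) (denM x.2 y.2).
Definition loc_opp (z : localization) : localization :=
  loc_frac (- (repr z).1) (repr z).2.
Definition loc_mul (z w : localization) : localization :=
  let x := repr z in let y := repr w in loc_frac (x.1 * y.1) (denM x.2 y.2).

Fact loc_frac_repr a s : exists2 u, u \in S &
  let x := repr (loc_frac a s) in u * (x.1 * sval s) = u * (a * sval x.2).
Proof.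
by apply/(loc_fracP _ (repr (loc_frac a s)).2); rewrite {1}/loc_frac -surjective_pairing reprK.
Qed.

Lemma loc_fracD a s b t : loc_add (loc_frac a s) (loc_frac b t) =
  loc_frac (a * sval t + b * sval s) (denM s t).
Proof.
rewrite /loc_add; have [u uS e] := loc_frac_repr a s.
have [v vS e'] := loc_frac_repr b t.
set x := repr _ in e *; set y := repr _ in e' *; rewrite /= in e e'.
apply/loc_fracP; exists (u * v); rewrite ?rpredM //=.
transitivity (v * sval y.2 * sval t * (u * (x.1 * sval s)) +
  u * sval x.2 * sval s * (v * (y.1 * sval t))); first by ring.
by rewrite e e'; ring.
Qed.

Lemma loc_fracN a s : loc_opp (loc_frac a s) = loc_frac (- a) s.
Proof.
rewrite /loc_opp; have [u uS e] := loc_frac_repr a s.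
by apply/loc_fracP; exists u; rewrite // !mulNr !mulrN e.
Qed.

Lemma loc_fracM a s b t :
  loc_mul (loc_frac a s) (loc_frac b t) = loc_frac (a * b) (denM s t).
Proof.
rewrite /loc_mul; have [u uS e] := loc_frac_repr a s.
have [v vS e'] := loc_frac_repr b t.
set x := repr _ in e *; set y := repr _ in e' *; rewrite /= in e e'.
apply/loc_fracP; exists (u * v); rewrite ?rpredM //=.
transitivity ((u * (x.1 * sval s)) * (v * (y.1 * sval t))); first by ring.
by rewrite e e'; ring.
Qed.

Fact loc_addA : associative loc_add.
Proof.
move=> z w v; have [a [s ->]] := loc_frac_surj z.
have [b [t ->]] := loc_frac_surj w; have [c [r ->]] := loc_frac_surj v.
rewrite !loc_fracD; apply/loc_fracP; exists 1; rewrite ?rpred1 //=; ring.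
Qed.

Fact loc_addC : commutative loc_add.
Proof.
move=> z w; have [a [s ->]] := loc_frac_surj z.
have [b [t ->]] := loc_frac_surj w.
rewrite !loc_fracD; apply/loc_fracP; exists 1; rewrite ?rpred1 //=; ring.
Qed.

Fact loc_add0 : left_id (loc_frac 0 den1) loc_add.
Proof.
move=> z; have [a [s ->]] := loc_frac_surj z.
rewrite !loc_fracD; apply/loc_fracP; exists 1; rewrite ?rpred1 //=; ring.
Qed.

Fact loc_addN : left_inverse (loc_frac 0 den1) loc_opp loc_add.
Proof.
move=> z; have [a [s ->]] := loc_frac_surj z.
rewrite loc_fracN loc_fracD; apply/loc_fracP; exists 1; rewrite ?rpred1 //=.
by ring.
Qed.

HB.instance Definition _ :=
  GRing.isZmodule.Build localization loc_addA loc_addC loc_add0 loc_addN.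

Fact loc_mulA : associative loc_mul.
Proof.
move=> z w v; have [a [s ->]] := loc_frac_surj z.
have [b [t ->]] := loc_frac_surj w; have [c [r ->]] := loc_frac_surj v.
rewrite !loc_fracM; apply/loc_fracP; exists 1; rewrite ?rpred1 //=; ring.
Qed.

Fact loc_mulC : commutative loc_mul.
Proof.
move=> z w; have [a [s ->]] := loc_frac_surj z.
have [b [t ->]] := loc_frac_surj w.
rewrite !loc_fracM; apply/loc_fracP; exists 1; rewrite ?rpred1 //=; ring.
Qed.

Fact loc_mul1 : left_id (loc_frac 1 den1) loc_mul.
Proof.
move=> z; have [a [s ->]] := loc_frac_surj z.
rewrite !loc_fracM; apply/loc_fracP; exists 1; rewrite ?rpred1 //=; ring.
Qed.

Fact loc_mulD : left_distributive loc_mul +%R.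
Proof.
move=> z w v; have [a [s ->]] := loc_frac_surj z.
have [b [t ->]] := loc_frac_surj w; have [c [r ->]] := loc_frac_surj v.
rewrite /GRing.add /= !(loc_fracM, loc_fracD); apply/loc_fracP.
exists 1; rewrite ?rpred1 //=; ring.
Qed.

HB.instance Definition _ := GRing.Zmodule_isComPzRing.Build localization
  loc_mulA loc_mulC loc_mul1 loc_mulD.

Definition to_loc (a : R) : localization := loc_frac a den1.

Fact to_loc_zmod_morphism : zmod_morphism to_loc.
Proof.
move=> a b; rewrite {2}/GRing.opp {2}/GRing.add /= loc_fracN loc_fracD.
by apply/loc_fracP; exists 1; rewrite ?rpred1 //=; ring.
Qed.

Fact to_loc_monoid_morphism : monoid_morphism to_loc.
Proof.
split=> // a b; rewrite {2}/GRing.mul /= loc_fracM.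
by apply/loc_fracP; exists 1; rewrite ?rpred1 //=; ring.
Qed.

HB.instance Definition _ :=
  GRing.isZmodMorphism.Build R localization to_loc to_loc_zmod_morphism.
HB.instance Definition _ :=
  GRing.isMonoidMorphism.Build R localization to_loc to_loc_monoid_morphism.

Definition ideal_ext (I : set R) : set localization := ideal_gen (to_loc @` I).

End Localization.

Arguments ideal_ext {R} S I.

Section Powers.
Variables (R : comPzRingType) (u : R).

Definition powers : {pred R} := [pred x | `[< exists n : nat, x = u ^+ n >]].

Fact powers1 : 1 \in powers.
Proof. by apply/asboolP; exists 0%N. Qed.

Fact powersM : {in powers &, forall x y, x * y \in powers}.
Proof.
move=> x y /asboolP[m ->] /asboolP[n ->]; apply/asboolP.
by exists (m + n)%N; rewrite exprD.
Qed.

HB.instance Definition _ := GRing.isMulClosed.Build R powers (conj powers1 powersM).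

End Powers.

(* Main.v *)
Require Import Defs.
From mathcomp Require Import all_boot all_order all_algebra.
From mathcomp Require Import boolp classical_sets cardinality.
From mathcomp Require Import ring.

(** If [r/1] lies in the tight closure of [a S^-1 R], then [d r^q] lies, up to a
    factor in [S] depending on [q = p^n], in [a^[q]] and hence in [a_n]; prime
    avoidance lets us take [d] outside all minimal primes of [R].  Decompose
    [a_n]: a component whose radical misses [S] already contains [d r^q].  If
    [s] in [S] lies in the radicals of all the other components, linear growth
    puts [s^(h q)] in those components, so [d (s^h r)^q] is in [a_n], hence in
    [(a^[q])^*].  As [s^h] has exponent exactly [q], a weak test element turns
    this into [s^h r] in [a^*].  One [s] serves for all [n] when [S] is the
    powers of [s], or when only finitely many associated primes occur. *)

Set Implicit Arguments.
Unset Strict Implicit.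
Unset Printing Implicit Defensive.

Import GRing.Theory.

Local Open Scope classical_set_scope.
Local Open Scope ring_scope.

(** * Ideals and elements off the minimal primes *)

Section Ideals.
Variable A : comPzRingType.
Implicit Types (I J K P Q X : set A) (c d : A).

Lemma ideal_gen_ideal X : is_ideal (ideal_gen X).
Proof.
split=> [M [[M0 _ _] _] //|x y Ix Iy M MX|a x Ix M MX]; have [[_ MD MM] _] := MX.
  by apply: MD; [apply: Ix|apply: Iy].
by apply: MM; apply: Ix.
Qed.

Lemma ideal_pow_exp I x h : I x -> ideal_pow I h (x ^+ h).
Proof.
move=> Ix; elim: h => [//|h IH].
by apply: sub_gen_smallest; exists x => //; exists (x ^+ h); rewrite // exprS.
Qed.

Lemma prime_exp P x n : prime_ideal P -> P (x ^+ n) -> P x.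
Proof.
move=> [_ P1 PM]; elim: n => [/P1//|n IH].
by rewrite exprS => /PM[].
Qed.

Lemma off_minimal_primesP c :
  off_minimal_primes c <-> forall P, minimal_prime P -> ~ P c.
Proof.
split=> [h P mP Pc|h [P mP Pc]]; first by apply: h; exists P.
exact: h mP Pc.
Qed.

Lemma off_minimal_primesM c d : off_minimal_primes c ->
  off_minimal_primes d -> off_minimal_primes (c * d).
Proof.
move=> /off_minimal_primesP hc /off_minimal_primesP hd.
apply/off_minimal_primesP => P mP; have [[_ _ PM] _] := mP.
by move=> /PM[]; [apply: hc|apply: hd].
Qed.

Lemma off_minimal_primesX c n :
  off_minimal_primes c -> off_minimal_primes (c ^+ n).
Proof.
move=> /off_minimal_primesP hc; apply/off_minimal_primesP => P mP.
by move=> /(prime_exp mP.1); apply: hc.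
Qed.

(** * Chain condition and Noetherian induction *)

Lemma noetherian_stationary (J : nat -> set A) : noetherian A ->
  (forall n, is_ideal (J n)) -> (forall n, J n `<=` J n.+1) ->
  exists n, J n.+1 `<=` J n.
Proof.
move=> hN Jid Jsub.
have Jle m n : (m <= n)%N -> J m `<=` J n.
  move=> /subnK <-; elim: (n - m)%N => [//|k IH].
  exact: subset_trans IH (Jsub _).
pose U := \bigcup_n J n.
have Uid : is_ideal U.
  split=> [|x y [m _ Jx] [n _ Jy]|b x [n _ Jx]].
  - by exists 0%N => //; have [] := Jid 0%N.
  - exists (maxn m n) => //; have [_ JD _] := Jid (maxn m n).
    by apply: JD; [apply: Jle Jx; apply: leq_maxl|apply: Jle Jy; apply: leq_maxr].
  - by exists n => //; have [_ _ JM] := Jid n; apply: JM.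
have [s Us] := hN U Uid.
have sU : [set` s] `<=` U by rewrite Us; apply: sub_gen_smallest.
(* The union is finitely generated and the chain increases, so one [J n] holds all the
   generators. *)
have [n sJ] : exists n, [set` s] `<=` J n.
  elim: s {Us} sU => [|x s IH] sU; first by exists 0%N.
  have [n sJ] : exists n, [set` s] `<=` J n.
    by apply: IH => y /= ys; apply: sU => /=; rewrite inE ys orbT.
  have [m _ xJ] : U x by apply: sU; rewrite /= mem_head.
  exists (maxn m n) => y /=; rewrite inE => /orP[/eqP->|/sJ].
    by apply: Jle xJ; apply: leq_maxl.
  by apply: Jle; apply: leq_maxr.
exists n; apply: (@subset_trans _ U) => [x Jx|]; first by exists n.+1.
by rewrite Us; apply: smallest_sub.
Qed.

(** Otherwise choice picks above each counterexample a strictly larger one, and iterating gives a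
    chain that never becomes stationary. *)
Lemma noetherian_induction (T : set A -> Prop) : noetherian A ->
  (forall I, is_ideal I ->
     (forall J, is_ideal J -> I `<=` J -> ~ J `<=` I -> T J) -> T I) ->
  forall I, is_ideal I -> T I.
Proof.
move=> hN step I Iid; apply: contrapT => nTI.
pose bad := {J : set A | is_ideal J /\ ~ T J}.
have /choice[next nextP] (J : bad) : exists J' : bad,
    sval J `<=` sval J' /\ ~ sval J' `<=` sval J.
  apply: contrapT => none; case: (svalP J) => Jid nTJ; apply: nTJ.
  apply: step => // J' J'id JJ' nJ'J; apply: contrapT => nTJ'; apply: none.
  by exists (exist _ J' (conj J'id nTJ')).
pose J n : bad := iter n next (exist _ I (conj Iid nTI)).
have [n] : exists n, sval (J n.+1) `<=` sval (J n).
  apply: noetherian_stationary => // n; first exact: (svalP (J n)).1.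
  exact: (nextP _).1.
exact: (nextP _).2.
Qed.

(** * Products of primes, minimal primes and prime avoidance *)

Definition prime_products (Ps : seq (set A)) : set A :=
  foldr (fun P X => [set x * y | x in P & y in X]) [set 1] Ps.

Lemma prime_products_cat (Ps Qs : seq (set A)) z : prime_products (Ps ++ Qs) z ->
  exists x y, [/\ prime_products Ps x, prime_products Qs y & z = x * y].
Proof.
elim: Ps z => [|P Ps IH] z /=; first by exists 1, z; rewrite mul1r.
move=> [x Px [w /IH[u [v [Pu Qv ->]]] <-]].
by exists (x * u), v; rewrite mulrA; split=> //; exists x => //; exists u.
Qed.

(** If [x y] is in [I] and neither factor is, then [(I + A x)(I + A y)] lies in [I], so the lists
    obtained by induction for these two larger ideals can be concatenated. *)
Lemma noetherian_prime_products I : noetherian A -> is_ideal I ->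
  exists Ps : seq (set A),
    (forall P, P \in Ps -> prime_ideal P) /\ prime_products Ps `<=` I.
Proof.
move=> hN; move: I; apply: noetherian_induction => // I Iid IH.
have [I0 ID IM] := Iid.
have [I1|nI1] := pselect (I 1); first by exists [::]; split=> // z /= ->.
have [Iprime|] := pselect (prime_ideal I).
  exists [:: I]; split=> [P|z]; first by rewrite inE => /eqP->.
  by move=> [x Ix [y -> <-]]; rewrite mulr1.
move=> nIprime; have [x [y [Ixy nIx nIy]]] :
    exists x y, [/\ I (x * y), ~ I x & ~ I y].
  apply: contrapT => none; apply: nIprime; split=> // x y Ixy.
  have [Ix|nIx] := pselect (I x); first by left.
  have [Iy|nIy] := pselect (I y); first by right.
  by case: none; exists x, y.
have add_gen t : ~ I t -> exists Ps : seq (set A),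
    (forall P, P \in Ps -> prime_ideal P) /\
    prime_products Ps `<=` [set i + b * t | i in I & b in setT].
  move=> nIt; apply: IH.
  - split=> [|_ _ [i Ii [b _ <-]] [j Ij [c _ <-]]|c _ [i Ii [b _ <-]]].
    + by exists 0 => //; exists 0 => //; rewrite mul0r addr0.
    + by exists (i + j); [apply: ID|exists (b + c) => //; ring].
    + by exists (c * i); [apply: IM|exists (c * b) => //; ring].
  - by move=> i Ii; exists i => //; exists 0; rewrite // mul0r addr0.
  - by move=> sub; apply/nIt/sub; exists 0 => //; exists 1; rewrite // mul1r add0r.
have [Ps [Pprime Psub]] := add_gen _ nIx.
have [Qs [Qprime Qsub]] := add_gen _ nIy.
exists (Ps ++ Qs); split=> [P|z].
  by rewrite mem_cat => /orP[/Pprime|/Qprime].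
move=> /prime_products_cat[_ [_ [/Psub[i Ii [b _ <-]] /Qsub[j Ij [c _ <-]] ->]]].
rewrite (_ : _ * _ = (j + c * y) * i + (b * x * j + b * c * (x * y))); last by ring.
by apply: (ID); [apply: IM|apply: (ID); apply: IM].
Qed.

Lemma prime_products_sub P Ps : prime_ideal P -> prime_products Ps `<=` P ->
  exists2 Q, Q \in Ps & Q `<=` P.
Proof.
move=> [Pid P1 PM]; elim: Ps => [|Q Ps IH] /= sub; first by case: P1; apply: sub.
have [QP|nQP] := pselect (Q `<=` P); first by exists Q; rewrite ?mem_head.
have [x [Qx nPx]] := nonsubset nQP.
have [|Q' Q'Ps Q'P] := IH; last by exists Q' => //; rewrite inE Q'Ps orbT.
move=> y Py; have [|//|//] := PM x y.
by apply: sub; exists x => //; exists y.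
Qed.

(** Some product of primes is zero, hence inside every minimal prime [P]; then [P] contains one of
    these primes and equals it by minimality. *)
Lemma minimal_primes_finite : noetherian A -> exists Ms : seq (set A),
  forall P, P \in Ms <-> minimal_prime P.
Proof.
move=> hN; have [|Ps [Pprime Psub]] := @noetherian_prime_products [set 0] hN.
  by split=> [//|_ _ -> ->|b _ ->]; rewrite /= ?addr0 ?mulr0.
exists [seq P <- Ps | `[<minimal_prime P>]] => P; rewrite mem_filter.
split=> [/andP[/asboolP] //|mP]; have [Pp Pmin] := mP.
have [|Q QPs QP] := @prime_products_sub P Ps Pp.
  by move=> z /Psub ->; have [[]] := Pp.
by have e := Pmin Q (Pprime Q QPs) QP; rewrite -{2}e QPs andbT; apply/asboolP.
Qed.

(* That is, [t] is nilpotent in the localization at [P]. *)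
Lemma minimal_prime_nilpotent P t : noetherian A -> minimal_prime P -> P t ->
  exists y n, ~ P y /\ y * t ^+ n = 0.
Proof.
move=> hN [Pp Pmin] Pt; have [_ P1 PM] := Pp.
have [|Ps [Pprime Psub]] := @noetherian_prime_products [set 0] hN.
  by split=> [//|_ _ -> ->|b _ ->]; rewrite /= ?addr0 ?mulr0.
suff [y [n [nPy /Psub]]] : exists y n, ~ P y /\ prime_products Ps (y * t ^+ n).
  by exists y, n.
elim: Ps Pprime {Psub} => [|Q Ps IH] Pprime.
  by exists 1, 0%N; rewrite mulr1.
have [|y [n [nPy yn]]] := IH.
  by move=> P' P'Ps; apply: Pprime; rewrite inE P'Ps orbT.
(* If [Q] lies in [P], it equals [P] by minimality and supplies one more factor [t]; otherwise it
   supplies a factor outside [P]. *)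
have [QP|nQP] := pselect (Q `<=` P).
  exists y, n.+1; split=> //=; exists t.
    by rewrite (Pmin Q) //; apply: Pprime; rewrite mem_head.
  by exists (y * t ^+ n); rewrite // exprS; ring.
have [x [Qx nPx]] := nonsubset nQP.
exists (x * y), n; split=> [/PM[]//|/=].
by exists x => //; exists (y * t ^+ n); rewrite // mulrA.
Qed.

Lemma prime_seq_avoid P (Ms : seq (set A)) : prime_ideal P ->
  (forall Q, Q \in Ms -> is_ideal Q /\ ~ Q `<=` P) ->
  exists2 y, ~ P y & forall Q, Q \in Ms -> Q y.
Proof.
move=> [_ P1 PM]; elim: Ms => [|Q Ms IH] hM; first by exists 1.
have [|y nPy My] := IH; first by move=> Q' h; apply: hM; rewrite inE h orbT.
have [|[_ _ QM] nQP] := hM Q; first by rewrite mem_head.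
have [x [Qx nPx]] := nonsubset nQP.
exists (x * y) => [/PM[]//|Q']; rewrite inE => /orP[/eqP->|Q'Ms].
  by rewrite mulrC; apply: QM.
have [|[_ _ Q'M] _] := hM Q'; first by rewrite inE Q'Ms orbT.
by apply: Q'M; apply: My.
Qed.

(** Prime avoidance for the coset [d + K]: the minimal primes are treated one at a time, correcting
    [k] without spoiling those already avoided. *)
Lemma coset_off_minimal_primes K d : noetherian A -> is_ideal K ->
  (forall P, minimal_prime P -> K `<=` P -> ~ P d) ->
  exists2 k, K k & off_minimal_primes (d + k).
Proof.
move=> hN [K0 KD KM] hK; have [Ms MsP] := minimal_primes_finite hN.
suff [k Kk hk] : exists2 k, K k & forall P, P \in Ms -> ~ P (d + k).
  by exists k => //; apply/off_minimal_primesP => P /MsP; apply: hk.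
have : forall P, P \in Ms -> minimal_prime P by move=> P /MsP.
elim: Ms {MsP} => [|P Ms IH] mM; first by exists 0.
have [|k Kk hk] := IH; first by move=> Q QM; apply: mM; rewrite inE QM orbT.
have mP : minimal_prime P by apply: mM; rewrite mem_head.
have [[[P0 PD PM] P1 Pp] Pmin] := mP.
have [Pdk|nPdk] := pselect (P (d + k)); last first.
  by exists k => // Q; rewrite inE => /orP[/eqP->|/hk].
(* A repetition of [P] in the list would contradict [hk]. Without one, minimality of [P] prevents
   the other primes from lying inside it. *)
have [PMs|nPMs] := boolP (P \in Ms); first by case: (hk P PMs).
have PN x : P x -> P (- x) by rewrite -mulN1r; apply: PM.
have /nonsubset[x [Kx nPx]] : ~ K `<=` P.
  move=> KP; apply: (hK P mP KP); rewrite -(addrK k d).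
  by apply: PD => //; apply/PN/KP.
have [||y nPy My] := @prime_seq_avoid P Ms; first by case: mP.
  move=> Q QMs; have [Qp _] : minimal_prime Q by apply: mM; rewrite inE QMs orbT.
  split=> [|QP]; first by case: Qp.
  by move: nPMs; rewrite -(Pmin Q Qp QP) QMs.
(* [y * x] lies in [K] and in every prime of [Ms] but not in [P]: it moves [d + k] out of [P] and
   into none of the others. *)
exists (k + y * x); first by apply: KD => //; apply: KM.
move=> Q; rewrite inE addrA => /orP[/eqP-> Pdkyx|QMs Qdkyx].
  suff /Pp[] : P (y * x) by [].
  by rewrite -(addKr (d + k) (y * x)); apply: PD => //; apply: PN.
have [[[_ QD QM] _ _] _] : minimal_prime Q by apply: mM; rewrite inE QMs orbT.
apply: (hk Q QMs); rewrite -(addrK (y * x) (d + k)); apply: QD => //.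
by rewrite -mulrN mulrC; apply: QM; apply: My.
Qed.

End Ideals.

(** * Frobenius powers and tight closure in characteristic [p] *)

Section Frobenius.
Variables (R : comNzRingType) (p : nat).
Hypothesis hp : p \in [pchar R].

Lemma exprDpn (x y : R) n : (x + y) ^+ (p ^ n) = x ^+ (p ^ n) + y ^+ (p ^ n).
Proof.
apply: exprDn_pchar; rewrite pnatX; apply/orP; left.
by rewrite pnatE ?(pcharf_prime hp).
Qed.

Lemma exp0pn n : (0 : R) ^+ (p ^ n) = 0.
Proof. by rewrite expr0n expn_eq0 eqn0Ngt prime_gt0 ?(pcharf_prime hp). Qed.

(** The [p^m]-th power map is additive, so the elements it sends into a given ideal form an ideal;
    checking generators is enough. *)
Lemma frobenius_power_exp (a : set R) m n x : frobenius_power p a n x ->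
  frobenius_power p a (n + m) (x ^+ (p ^ m)).
Proof.
have [J0 JD JM] := ideal_gen_ideal [set x ^+ (p ^ (n + m)) | x in a].
apply: (@smallest_sub _ _ _ [set x | frobenius_power p a (n + m) (x ^+ (p ^ m))]).
  split=> /= [|y z hy hz|b y hy]; first by rewrite exp0pn.
    by rewrite exprDpn; apply: JD.
  by rewrite exprMn; apply: JM.
move=> _ [y ay <-] /=; apply: sub_gen_smallest; exists y => //.
by rewrite -exprM -expnD.
Qed.

Lemma frobenius_power_frobenius_power (a : set R) m n :
  frobenius_power p (frobenius_power p a n) m `<=` frobenius_power p a (n + m).
Proof.
apply: smallest_sub; first exact: ideal_gen_ideal.
by move=> _ [x ax <-]; apply: frobenius_power_exp.
Qed.

Lemma tight_closure_ideal (a : set R) : is_ideal (tight_closure p a).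
Proof.
split.
- exists 1; first by apply/off_minimal_primesP => P [[]].
  exists 0%N => n _; rewrite exp0pn mulr0.
  by have [] := ideal_gen_ideal [set x ^+ (p ^ n) | x in a].
- move=> x y [c hc [M hM]] [d hd [N hN]].
  exists (c * d); first exact: off_minimal_primesM.
  exists (maxn M N) => n; rewrite geq_max => /andP[Mn Nn].
  have [_ JD JM] := ideal_gen_ideal [set x ^+ (p ^ n) | x in a].
  rewrite exprDpn (_ : _ * _ = d * (c * x ^+ (p ^ n)) + c * (d * y ^+ (p ^ n))).
    by apply: JD; apply: JM; [apply: hM|apply: hN].
  by ring.
- move=> b x [c hc [M hM]]; exists c => //; exists M => n Mn.
  have [_ _ JM] := ideal_gen_ideal [set x ^+ (p ^ n) | x in a].
  by rewrite exprMn mulrCA; apply: JM; apply: hM.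
Qed.

End Frobenius.

(** * Ideals, primes and Frobenius powers in a localization *)

Section Localization.
Variables (R : comNzRingType) (S : mulrClosed R).
Implicit Types (c d : R) (I P : set R) (Q : set (localization S)) (z : localization S).
Local Notation dens := {s : R | s \in S}.

(** An elementwise form of the extended ideal: when [I] is an ideal, common denominators turn sums
    of fractions into single fractions. *)
Definition fractions I : set (localization S) :=
  [set z | exists2 x, I x & exists s : dens, z = loc_frac x s].

Lemma locM (a b : R) (s t : dens) :
  loc_frac a s * loc_frac b t = loc_frac (a * b) (denM s t).
Proof. exact: loc_fracM. Qed.

Lemma locD (a b : R) (s t : dens) : loc_frac a s + loc_frac b t =
  loc_frac (a * sval t + b * sval s) (denM s t).
Proof. exact: loc_fracD. Qed.

Lemma denX_proof (s : dens) n : sval s ^+ n \in S.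
Proof. by rewrite rpredX // (valP s). Qed.

Definition denX (s : dens) n : dens := exist _ (sval s ^+ n) (denX_proof s n).

Lemma locX (a : R) (s : dens) n : loc_frac a s ^+ n = loc_frac (a ^+ n) (denX s n).
Proof.
elim: n => [|n IH]; first by apply/loc_fracP; exists 1; rewrite ?rpred1.
rewrite exprS IH locM; apply/loc_fracP; exists 1; rewrite ?rpred1 //=.
by rewrite !exprS.
Qed.

Lemma loc_frac_to_loc (a : R) (s : dens) :
  loc_frac a s = loc_frac 1 s * to_loc S a.
Proof.
by rewrite locM; apply/loc_fracP; exists 1; rewrite ?rpred1 //=; ring.
Qed.

Lemma to_loc_frac (a : R) (s : dens) :
  to_loc S a = to_loc S (sval s) * loc_frac a s.
Proof.
by rewrite locM; apply/loc_fracP; exists 1; rewrite ?rpred1 //=; ring.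
Qed.

(** The numerator of a given representative may lie outside [I]; the factor [u] absorbs the change
    of representative. *)
Lemma mem_fractions I (a : R) (s : dens) : is_ideal I ->
  fractions I (loc_frac a s) <-> exists2 u, u \in S & I (u * a).
Proof.
move=> [_ _ IM]; split=> [[x Ix [t /loc_fracP[u uS e]]]|[u uS Iua]].
  exists (u * sval t); first by rewrite rpredM // (valP t).
  rewrite (_ : _ * a = (u * sval s) * x); first exact: IM.
  by rewrite -[LHS]mulrA (mulrC (sval t)) e; ring.
exists (u * a) => //; exists (denM (exist _ u uS) s).
by apply/loc_fracP; exists 1; rewrite ?rpred1 //=; ring.
Qed.

Lemma fractions_ideal I : is_ideal I -> is_ideal (fractions I).
Proof.
move=> [I0 ID IM]; split.
- by exists 0 => //; exists (den1 S).
- move=> _ _ [x Ix [s ->]] [y Iy [t ->]]; rewrite locD.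
  exists (x * sval t + y * sval s); last by exists (denM s t).
  by apply: ID; rewrite mulrC; apply: IM.
- move=> z _ [x Ix [s ->]]; have [a [t ->]] := loc_frac_surj z.
  by rewrite locM; exists (a * x); [apply: IM|exists (denM t s)].
Qed.

Lemma ideal_ext_fractions I : is_ideal I -> ideal_ext S I = fractions I.
Proof.
move=> Iid; apply/seteqP; split.
  apply: smallest_sub; first exact: fractions_ideal.
  by move=> _ [x Ix <-]; exists x => //; exists (den1 S).
move=> _ [x Ix [s ->]]; rewrite loc_frac_to_loc.
have [_ _ JM] := ideal_gen_ideal (to_loc S @` I).
by apply: JM; apply: sub_gen_smallest; exists x.
Qed.

(** Powers of fractions are fractions of powers, which gives one inclusion. For the other, the
    preimage of the left side in [R] is an ideal containing the [p^n]-th powers of elements of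
    [I]. *)
Lemma frobenius_power_fractions p I n : is_ideal I ->
  frobenius_power p (fractions I) n = fractions (frobenius_power p I n).
Proof.
move=> Iid; apply/seteqP; split.
  apply: smallest_sub; first by apply/fractions_ideal/ideal_gen_ideal.
  move=> _ [_ [x Ix [s ->]] <-]; rewrite locX; exists (x ^+ (p ^ n)).
    by apply: sub_gen_smallest; exists x.
  by exists (denX s (p ^ n)).
rewrite -ideal_ext_fractions; last exact: ideal_gen_ideal.
have Jid := ideal_gen_ideal [set z ^+ (p ^ n) | z in fractions I].
apply: smallest_sub => // _ [x Ix <-]; move: x Ix.
apply: (@smallest_sub _ _ _ [set x | frobenius_power p (fractions I) n (to_loc S x)]).
  have [J0 JD JM] := Jid.
  split=> /= [|x y Jx Jy|b x Jx]; first by rewrite raddf0.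
    by rewrite raddfD; apply: JD.
  by rewrite rmorphM; apply: JM.
move=> _ [x Ix <-] /=; rewrite rmorphXn; apply: sub_gen_smallest.
by exists (to_loc S x) => //; exists x => //; exists (den1 S).
Qed.

(** The factor from [S] in [mem_fractions] is outside [P] and cancels by primality, so membership of
    a fraction depends on its numerator alone. *)
Lemma prime_fractions P : prime_ideal P -> (forall s, s \in S -> ~ P s) ->
  prime_ideal (fractions P) /\ (to_loc S @^-1` fractions P = P).
Proof.
move=> [Pid P1 PM] PS.
have memP (a : R) (s : dens) : fractions P (loc_frac a s) <-> P a.
  rewrite mem_fractions //; split=> [[u uS /PM[/(PS u uS)|]]//|Pa].
  by exists 1; rewrite ?rpred1 ?mul1r.
split; last by apply/seteqP; split=> x; rewrite /= memP.
split; [exact: fractions_ideal|by move=> /memP|move=> z w].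
have [x [s ->]] := loc_frac_surj z; have [y [t ->]] := loc_frac_surj w.
by rewrite locM !memP; apply: PM.
Qed.

Lemma prime_contraction Q : prime_ideal Q ->
  prime_ideal (to_loc S @^-1` Q) /\ (forall s, s \in S -> ~ Q (to_loc S s)).
Proof.
move=> [[Q0 QD QM] Q1 Qp]; split.
  split.
  - split=> /= [|x y Qx Qy|b x Qx]; rewrite ?raddf0 ?raddfD ?rmorphM //.
      exact: QD.
    exact: QM.
  - by rewrite /= rmorph1.
  - by move=> x y; rewrite /= rmorphM; apply: Qp.
move=> s sS Qs; apply: Q1; pose t : dens := exist _ s sS.
rewrite (_ : 1 = loc_frac 1 t * to_loc S s); first exact: QM.
by rewrite locM; apply/loc_fracP; exists 1; rewrite ?rpred1 //=; ring.
Qed.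

(** Up to the unit [1/s] every element comes from [R], so inclusions of ideals can be tested after
    contraction. *)
Lemma contraction_sub Q Q' : is_ideal Q' ->
  to_loc S @^-1` Q `<=` to_loc S @^-1` Q' -> is_ideal Q -> Q `<=` Q'.
Proof.
move=> [_ _ Q'M] sub [_ _ QM] z Qz; have [x [s e]] := loc_frac_surj z.
rewrite e loc_frac_to_loc; apply/Q'M/sub => /=.
by rewrite (to_loc_frac x s) -e; apply: QM.
Qed.

Lemma minimal_prime_fractions P : minimal_prime P ->
  (forall s, s \in S -> ~ P s) -> minimal_prime (fractions P).
Proof.
move=> [Pp Pmin] PS; have [FPp FPc] := prime_fractions Pp PS.
split=> // Q Qp QP; apply/seteqP; split=> //.
have [Qcp QS] := prime_contraction Qp.
apply: contraction_sub; [by case: Qp| |by case: FPp].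
rewrite FPc -(Pmin _ Qcp) // -[X in _ `<=` X]FPc.
by move=> x /=; apply: QP.
Qed.

Lemma minimal_prime_contraction Q :
  minimal_prime Q -> minimal_prime (to_loc S @^-1` Q).
Proof.
move=> [Qp Qmin]; have [Qcp QS] := prime_contraction Qp; split=> // P Pp PQ.
have PS s : s \in S -> ~ P s by move=> sS /PQ; apply: QS.
have [FPp FPc] := prime_fractions Pp PS.
rewrite -FPc (Qmin _ FPp) //.
apply: contraction_sub; [by case: Qp|by rewrite FPc|by case: FPp].
Qed.

Lemma off_minimal_primes_to_loc c :
  off_minimal_primes c -> off_minimal_primes (to_loc S c).
Proof.
move=> /off_minimal_primesP hc; apply/off_minimal_primesP => Q.
by move=> /minimal_prime_contraction; apply: hc.
Qed.

(* A minimal prime containing the kernel of [R -> S^-1 R] avoids [S], because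
   the elements of a minimal prime are nilpotent in the localization at it. *)
Lemma off_minimal_primes_lift (d : R) (s : dens) : noetherian R ->
  off_minimal_primes (loc_frac d s) ->
  exists2 k, (exists2 u, u \in S & u * k = 0) & off_minimal_primes (d + k).
Proof.
move=> hN /off_minimal_primesP hd.
(* Moving [d] within its coset of the kernel leaves [d/s] unchanged, so prime avoidance is applied
   to that coset. *)
apply: (@coset_off_minimal_primes _ [set k | exists2 u, u \in S & u * k = 0]) => //.
  split=> [|x y [u uS ux] [v vS vy]|b x [u uS ux]].
  - by exists 1; rewrite ?rpred1 ?mulr0.
  - exists (u * v); first exact: rpredM.
    rewrite (_ : _ * _ = v * (u * x) + u * (v * y)); last by ring.
    by rewrite ux vy !mulr0 addr0.
  - by exists u => //; rewrite mulrCA ux mulr0.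
move=> P mP KP Pd; have PS t : t \in S -> ~ P t.
  move=> tS Pt; have [y [n [nPy yn]]] := minimal_prime_nilpotent hN mP Pt.
  by apply/nPy/KP; exists (t ^+ n); rewrite ?rpredX // mulrC.
apply: (hd _ (minimal_prime_fractions mP PS)).
by exists d => //; exists s.
Qed.

End Localization.

Arguments fractions {R} S I.

(** * Tight closure under localization *)

Section TightClosure.
Variables (R : comNzRingType) (p : nat).
Hypothesis hp : p \in [pchar R].
Implicit Types (I a : set R).

Lemma fractions_tight_closure (S : mulrClosed R) a : is_ideal a ->
  fractions S (tight_closure p a) `<=` tight_closure p (fractions S a).
Proof.
move=> aid _ [r [c hc [N hN]] [s ->]]; exists (to_loc S c).
  exact: off_minimal_primes_to_loc.
exists N => n Nn; rewrite frobenius_power_fractions // locX locM.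
exists (c * r ^+ (p ^ n)); first exact: hN.
by exists (denM (den1 S) (denX s (p ^ n))).
Qed.

Lemma primary_decomposition_saturation (S : mulrClosed R) I k
    (q : 'I_k -> set R) n h s u x :
  minimal_primary_decomposition I q ->
  (forall i, ideal_pow (frobenius_power p (radical (q i)) n) h `<=` q i) ->
  (forall P, ass I P -> forall t, t \in S -> P t -> P s) ->
  u \in S -> I (u * x) -> I ((s ^+ h) ^+ (p ^ n) * x).
Proof.
move=> Iq growth hs uS Iux; have [qprim Iqcap _ _] := Iq.
rewrite Iqcap => i _; have [[_ _ qM] _ qp] := qprim i.
have qux : q i (x * u) by move: Iux; rewrite Iqcap mulrC; apply.
have [qx|qu] := qp _ _ qux; first exact: qM.
(* Here [u], hence [s], is in the radical of [q i]. Swapping the exponents shows an [h]-th power of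
   [s ^+ (p ^ n)], to which the growth bound applies. *)
rewrite mulrC exprAC; apply: (qM); apply: growth; apply: ideal_pow_exp.
apply: sub_gen_smallest; exists s => //.
by apply: (hs) uS qu; exists k, q; split=> //; exists i.
Qed.

(** Common core of both assertions: a single [s] in [S] lies in every associated prime of every
    [a_n] that meets [S]. *)
Lemma tight_closure_localization a (a_ : nat -> set R) (S : mulrClosed R) (s : R) :
  noetherian R -> (exists (m0 : nat) (c : R), weak_test_element p m0 c) ->
  is_ideal a -> linear_growth p a_ ->
  (forall n, frobenius_power p a n `<=` a_ n) ->
  (forall n, a_ n `<=` tight_closure p (frobenius_power p a n)) ->
  s \in S ->
  (forall n P, ass (a_ n) P -> forall t, t \in S -> P t -> P s) ->
  ideal_ext S (tight_closure p a) = tight_closure p (ideal_ext S a).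
Proof.
move=> hN [m0 [c [hc test]]] aid [_ _ [h _ growth]] hle hge sS hs.
rewrite !ideal_ext_fractions //; last exact: tight_closure_ideal.
apply/seteqP; split; first exact: fractions_tight_closure.
move=> z [c' + [N]]; have [r [t ->]] := loc_frac_surj z.
have [d [v ->]] := loc_frac_surj c'.
move=> /(off_minimal_primes_lift hN)[k [w wS wk] hdk] hr.
apply/mem_fractions; first exact: tight_closure_ideal.
exists (s ^+ h); first exact: rpredX.
(* [c] is the weak test element. The other factor is what [d + k] becomes when a relation at level
   [l] is raised to the power [p ^ m0]. *)
exists (c * (d + k) ^+ (p ^ m0)).
  by apply: off_minimal_primesM => //; apply: off_minimal_primesX.
(* Writing [n = l + m0] leaves [l] at least [N] for the hypothesis on [r], and [m0] for the test
   element. *)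
exists (N + m0)%N => n Nn.
have [l nE Nl] : exists2 l, n = (l + m0)%N & (N <= l)%N.
  have m0n := leq_trans (leq_addl _ _) Nn.
  exists (n - m0)%N; first by rewrite subnK.
  by rewrite -(leq_add2r m0) subnK.
rewrite {n Nn}nE.
have : a_ l ((s ^+ h) ^+ (p ^ l) * ((d + k) * r ^+ (p ^ l))).
  have := hr l Nl; rewrite frobenius_power_fractions // locX locM.
  move=> /mem_fractions[|u uS Jdr]; first exact: ideal_gen_ideal.
  have [i [q [Iq qgrowth]]] := growth l.
  (* [u] brings [d * r ^+ (p ^ l)] into the Frobenius power and [w] kills [k], so [u * w] does
     both. *)
  apply: (primary_decomposition_saturation (u := u * w) Iq qgrowth (hs l)).
    exact: rpredM.
  apply: hle; have [_ _ JM] := ideal_gen_ideal [set x ^+ (p ^ l) | x in a].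
  rewrite (_ : _ * _ = w * (u * (d * r ^+ (p ^ l))) + u * (w * k) * r ^+ (p ^ l)).
    by rewrite wk mulr0 mul0r addr0; apply: JM.
  by ring.
(* The test is used only at the exponent [m0], on the ideal [a^[p^l]]; as [c] is independent of [l],
   this yields one multiplier for all large [n]. *)
move=> /hge tc; have := (test _ (ideal_gen_ideal _) _).1 tc m0 (leqnn _).
move=> /(frobenius_power_frobenius_power hp).
rewrite !exprMn -!exprM -mulnA -expnD.
by rewrite (mulrCA (s ^+ _)) !mulrA.
Qed.

(** Multiply one element of [P] and [S] for each [P] in the list that meets [S]; a [P] missing [S]
    imposes no condition. *)
Lemma exists_common_element (S : mulrClosed R) (Ps : seq (set R)) :
  (forall P, P \in Ps -> forall x y, P x -> P (x * y)) ->
  exists2 s, s \in S & forall P, P \in Ps -> forall t, t \in S -> P t -> P s.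
Proof.
elim: Ps => [|P Ps IH] PM; first by exists 1; rewrite ?rpred1.
have [|s sS hs] := IH; first by move=> Q QPs; apply: PM; rewrite inE QPs orbT.
have sP u Q t : Q \in Ps -> t \in S -> Q t -> Q (s * u).
  move=> QPs tS Qt; apply: PM; first by rewrite inE QPs orbT.
  exact: hs tS Qt.
have [[u uS Pu]|nP] := pselect (exists2 u, u \in S & P u); last first.
  exists s => // Q; rewrite inE => /orP[/eqP-> t tS Pt|]; last exact: hs.
  by case: nP; exists t.
exists (s * u); first exact: rpredM.
move=> Q; rewrite inE => /orP[/eqP-> _ _ _|QPs t tS]; last exact: sP tS.
by rewrite mulrC; apply: PM; rewrite ?mem_head.
Qed.

End TightClosure.

Theorem theorem7p6 (R : comNzRingType) (p : nat) (hp : p \in [pchar R])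
    (hN : noetherian R)
    (hc : exists (m0 : nat) (c : R), weak_test_element p m0 c)
    (a : set R) (ha : is_ideal a) (ha1 : a <> setT)
    (a_ : nat -> set R) (hf : f_sequence p a_) (hlin : linear_growth p a_)
    (hle : forall n : nat, frobenius_power p a n `<=` a_ n)
    (hge : forall n : nat, a_ n `<=` tight_closure p (frobenius_power p a n)) :
  (forall u : R,
     ideal_ext (powers u) (tight_closure p a) =
     tight_closure p (ideal_ext (powers u) a)) /\
  (finite_set (\bigcup_n ass (a_ n)) ->
   forall S : mulrClosed R,
     ideal_ext S (tight_closure p a) = tight_closure p (ideal_ext S a)).
Proof.
split=> [u|/finite_seqP[Ps PsE] S].
  (* Elements of [S] are powers of [u], so a radical ideal meeting [S] contains [u]. *)
  apply: (tight_closure_localization (a_ := a_) (s := u) hp) => //.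
    by apply/asboolP; exists 1%N.
  move=> n _ [k [q [_ [i ->]]]] t /asboolP[m ->] [l].
  by rewrite -exprM; exists (m * l)%N.
have PsP P : P \in Ps <-> (\bigcup_n ass (a_ n)) P by rewrite PsE.
have [|s sS hs] := @exists_common_element R S Ps.
  move=> _ /PsP[n _ [k [q [[qprim _ _ _] [i ->]]]]] x y [l qx].
  have [[_ _ qM] _ _] := qprim i.
  by exists l; rewrite exprMn mulrC; apply: qM.
apply: (tight_closure_localization (a_ := a_) (s := s) hp) => // n P nP.
by apply: hs; apply/PsP; exists n.
Qed.
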